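(* There exists a strictly increasing sequence of nonnegative integers $(n_k)_{k\ge1}$ with $n_{k+1}-n_k\to\infty$ as $k\to\infty$ (in particular $(n_k)$ has zero Banach density) which is universally $L^1$-good in the following sense: for every invertible, aperiodic, ergodic measure-preserving transformation $T$ of a probability space $(X,\Sigma,\mu)$ and every $f\in L^1(\mu)$, $$\lim_{K\to\infty}\frac1K\sum_{k=1}^{K}f(T^{n_k}x)=\int_X f\,d\mu$$ for $\mu$-almost every $x\in X$.
   Context: A dynamical system $(X,\Sigma,\mu,T)$ consists of a probability space $(X,\Sigma,\mu)$ and an invertible measure-preserving transformation $T:X\to X$; aperiodic means that the set of periodic points of $T$ has measure zero; ergodic means every $T$-invariant measurable set has measure $0$ or $1$. *)

(* Defs.v *)
From HB Require Import structures.
From mathcomp Require Import all_boot all_order all_algebra.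
From mathcomp Require Import all_classical all_reals all_analysis.
Set Implicit Arguments. Unset Strict Implicit. Unset Printing Implicit Defensive.
Import Order.TTheory GRing.Theory Num.Theory.
Local Open Scope classical_set_scope.
Local Open Scope ring_scope.

Definition invertible_mpt d (X : measurableType d) (R : realType)
    (mu : {measure set X -> \bar R}) (T : X -> X) : Prop :=
  measurable_fun setT T /\
  (exists Tinv : X -> X,
      measurable_fun setT Tinv /\ cancel T Tinv /\ cancel Tinv T) /\
  (forall A, measurable A -> mu (T @^-1` A) = mu A).

Definition aperiodic d (X : measurableType d) (R : realType)
    (mu : {measure set X -> \bar R}) (T : X -> X) : Prop :=
  mu.-negligible [set x | exists p : nat, (0 < p)%N /\ iter p T x = x].

Definition ergodic d (X : measurableType d) (R : realType)
    (mu : {measure set X -> \bar R}) (T : X -> X) : Prop :=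
  forall A, measurable A -> T @^-1` A = A -> mu A = 0%E \/ mu A = 1%E.

(* Main.v *)
(* The sequence has one term in each cell of a partition of [0, oo) into
   intervals.  In phase i the cells have length (i+1)(i+2), and the term sits at
   an offset, the letter, in the initial window of length (i+1)^2; so gaps in
   phase i exceed i+1 while the windows fill a proportion 1 - 1/(i+2) of the
   cells.  The letters of phase i run through all words of a length L_i,
   concatenated, and this period is repeated very many times.  Averaging over
   all words makes distinct letters exactly orthogonal, so the average of v over
   one period differs from its average over all windows by at most
   L_i^(-1/2) |v|_2 in L^2, for every measure-preserving T.

   Let f >= 0 be integrable.  By Borel-Cantelli, f(T^(n_k) x) <= k+1 eventually,
   so in phase i one may replace f by low + mid, where low = f 1[f <= cutoff i],
   mid = f 1[cutoff i < f <= start (i+1)], and cutoff i is the number of terms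
   before phase i-1.  The mid parts have summable integrals, since the intervals
   overlap at most twice, and L_i is so large compared with cutoff i that the
   errors made on low are summable in L^1.  The maximal ergodic inequality for
   the power of T that shifts by one period, and Borel-Cantelli, make both
   uniformly negligible within late phases.  What remains is a sum of f over
   windows, which is at most a weighted Birkhoff sum with decreasing weights,
   handled by Abel summation and the ergodic theorem.  Hence the limsup of the
   averages is at most the integral of f.  Adding constants gives this for f
   bounded below, truncation gives it for all f, and applying it to -f
   concludes. *)
Require Import Defs.
From HB Require Import structures.
From mathcomp Require Import all_boot all_order all_algebra.
From mathcomp Require Import all_classical all_reals all_analysis.
From mathcomp Require Import measurable_realfun zify ring lra.
Import Order.TTheory GRing.Theory Num.Theory.
Local Open Scope classical_set_scope.
Local Open Scope ring_scope.

(** * Construction of the sequence: phases, periods, letters, positions *)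

Section sequence.
Local Open Scope nat_scope.

(** Words of length [L] over [w] letters are coded by the numbers below [w ^ L]: letter [l] is the
    base-[w] digit of weight [w ^ l]. *)
Definition digit (w q l : nat) : nat := (q %/ w ^ l) %% w.

Definition window (i : nat) : nat := i.+1 ^ 2.
Definition cell (i : nat) : nat := i.+1 * i.+2.

(** With [t] the cutoff, [t.+1] outweighs the sup norm of the low part, and [4 ^ i] leaves an [L^1]
    error of order [1 / 2 ^ i] in phase [i]. *)
Definition wordlen (i t : nat) : nat := 4 ^ i * t.+1.
Definition period (i t : nat) : nat := wordlen i t * window i ^ wordlen i t.

(* [sched i] is (cutoff i, start i); the number of periods in phase i makes
   start (i+1) at least (i+1) times the period of phase i+1. *)
Fixpoint sched (i : nat) : nat * nat :=
  if i is i'.+1 then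
    let: (t, s) := sched i' in
    (s, s + i'.+1 * period i'.+1 s * period i' t)
  else (0, 0).

Definition start (i : nat) : nat := (sched i).2.
Definition cutoff (i : nat) : nat := (sched i).1.
Definition wlen (i : nat) : nat := wordlen i (cutoff i).
Definition plen (i : nat) : nat := period i (cutoff i).

Lemma cutoffS i : cutoff i.+1 = start i.
Proof. by rewrite /cutoff /start /=; case: (sched i). Qed.

Lemma startS i : start i.+1 = start i + i.+1 * plen i.+1 * plen i.
Proof. by rewrite /plen cutoffS /cutoff /start /=; case: (sched i). Qed.

Lemma plenE i : plen i = wlen i * window i ^ wlen i.
Proof. by []. Qed.

Lemma window_gt0 i : 0 < window i.
Proof. by rewrite /window expn_gt0. Qed.

Lemma wlenE i : wlen i = 4 ^ i * (cutoff i).+1.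
Proof. by []. Qed.

Lemma wlen_gt0 i : 0 < wlen i.
Proof. by rewrite wlenE muln_gt0 expn_gt0. Qed.

Lemma plen_gt0 i : 0 < plen i.
Proof. by rewrite plenE muln_gt0 wlen_gt0 expn_gt0 window_gt0. Qed.

Lemma start_ltS i : start i < start i.+1.
Proof.
rewrite startS; have := plen_gt0 i; have := plen_gt0 i.+1.
by move: (plen i) (plen i.+1) => a b; nia.
Qed.

Lemma start_mono : {homo start : i j / i <= j}.
Proof.
by apply: homo_leq => // [j i k|i]; [exact: leq_trans|exact/ltnW/start_ltS].
Qed.

Lemma start_ge i : i <= start i.
Proof. by elim: i => // i IH; apply: leq_ltn_trans IH (start_ltS i). Qed.

(** This makes an unfinished period of phase [i] cost at most a proportion [1 / i] of the terms
    before the phase. *)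
Lemma plen_le_start i : i * plen i <= start i.
Proof.
case: i => [//|i]; rewrite startS (leq_trans _ (leq_addl _ _))//.
by rewrite leq_pmulr ?plen_gt0.
Qed.

Lemma cutoff_le_start i : cutoff i <= start i.
Proof. by case: i => [//|i]; rewrite cutoffS ltnW ?start_ltS. Qed.

Lemma phase_ex k : exists i, k < start i.+1.
Proof. by exists k; exact: start_ge. Qed.

Definition phase (k : nat) : nat := ex_minn (phase_ex k).

Lemma phaseP k : start (phase k) <= k < start (phase k).+1.
Proof.
rewrite /phase; case: ex_minnP => i -> imin; rewrite andbT.
case: i imin => [//|i] imin; rewrite leqNgt; apply/negP => /imin.
by rewrite ltnn.
Qed.

Lemma phaseE i k : start i <= k < start i.+1 -> phase k = i.
Proof.
move=> /andP[ik ki]; have /andP[pk kp] := phaseP k.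
apply/eqP; rewrite eqn_leq; apply/andP; split; rewrite leqNgt; apply/negP => h.
  by have := leq_trans ki (leq_trans (start_mono _ _ h) pk); rewrite ltnn.
by have := leq_trans kp (leq_trans (start_mono _ _ h) ik); rewrite ltnn.
Qed.

Lemma phase_ge i k : start i <= k -> i <= phase k.
Proof.
move=> ik; rewrite leqNgt; apply/negP => h; have /andP[_ kp] := phaseP k.
by have := leq_trans kp (leq_trans (start_mono _ _ h) ik); rewrite ltnn.
Qed.

Lemma phase_mono : {homo phase : k l / k <= l}.
Proof.
move=> k l kl; apply: phase_ge; apply: leq_trans kl.
by have /andP[] := phaseP k.
Qed.

Definition pos (k : nat) : nat := \sum_(m < k) cell (phase m).

Definition letter (k : nat) : nat :=
  let i := phase k in
  digit (window i) ((k - start i) %/ wlen i) ((k - start i) %% wlen i).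

Definition seqn (k : nat) : nat := pos k + letter k.

Lemma posS k : pos k.+1 = pos k + cell (phase k).
Proof. by rewrite /pos big_ord_recr. Qed.

Lemma letter_lt k : letter k < window (phase k).
Proof. by rewrite ltn_mod window_gt0. Qed.

Lemma cellE i : cell i = window i + i.+1.
Proof. by rewrite /cell /window; lia. Qed.

Lemma seqn_gap k : seqn k + phase k < seqn k.+1.
Proof.
rewrite /seqn posS cellE; have := letter_lt k; lia.
Qed.

Lemma posD i m : start i + m <= start i.+1 ->
  pos (start i + m) = pos (start i) + m * cell i.
Proof.
elim: m => [|m IH] h; first by rewrite mul0n !addn0.
have h' : start i + m < start i.+1 by rewrite -addnS.
rewrite addnS posS IH; last exact: ltnW.
by rewrite (phaseE i) ?leq_addr// mulSn -addnA [_ + cell i]addnC.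
Qed.

(** A multiple of [w ^ L] alters only the digits from position [L] on, so in [letter] the list of
    words repeats by itself. *)
Lemma digitD w L q b l : 0 < w -> l < L ->
  digit w (q * w ^ L + b) l = digit w b l.
Proof.
move=> w0 lL; rewrite /digit.
have -> : q * w ^ L = (q * w ^ (L - l.+1) * w) * w ^ l.
  by rewrite -!mulnA -expnS -expnD; congr (_ * (_ ^ _)); lia.
by rewrite divnMDl ?expn_gt0 ?w0// modnMDl.
Qed.

(** All periods of a phase are translates of the first one, so sums over periods become Birkhoff
    sums for a power of the map. *)
Lemma seqn_block i q r : r < plen i ->
    start i + q * plen i + r < start i.+1 ->
  seqn (start i + q * plen i + r) =
  pos (start i) + q * (plen i * cell i) +
    (r * cell i + digit (window i) (r %/ wlen i) (r %% wlen i)).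
Proof.
move=> rs h; rewrite /seqn /letter (phaseE i); last by apply/andP; split; lia.
set w := window i; set L := wlen i.
have -> : start i + q * plen i + r - start i = q * w ^ L * L + r.
  by rewrite plenE -/w -/L; lia.
rewrite divnMDl ?wlen_gt0// modnMDl digitD ?window_gt0 ?ltn_mod ?wlen_gt0//.
rewrite -addnA posD; last lia.
by rewrite mulnDl; lia.
Qed.

End sequence.

(** * Finite sums: orthogonality over words and Abel summation *)

Lemma sum_blocks (V : nmodType) (F : nat -> V) N s :
  \sum_(k < N * s) F k = \sum_(q < N) \sum_(r < s) F (q * s + r)%N.
Proof.
elim: N => [|N IH]; first by rewrite mul0n !big_ord0.
by rewrite mulSnr big_split_ord /= IH big_ord_recr.
Qed.

(* The mean over all words kills the cross terms between distinct letters. *)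
Lemma sum_words_sqr (R : comPzRingType) (y : nat -> nat -> R) w L :
  (0 < w)%N -> (forall l, \sum_(a < w) y l a = 0) ->
  (\sum_(q < w ^ L) (\sum_(l < L) y l (digit w q l)) ^+ 2) * w%:R =
  (w ^ L)%:R * \sum_(l < L) \sum_(a < w) y l a ^+ 2.
Proof.
move=> w0; elim: L y => [|L IH] y y0.
  by rewrite !big_ord0 mulr0 expn0 big_ord1 big_ord0 expr0n mul0r.
rewrite expnSr (sum_blocks _ (fun q => (\sum_(l < L.+1) y l (digit w q l)) ^+ 2)).
pose Z q := \sum_(l < L) y l.+1 (digit w q l).
(* The lowest digit [a] is split off, and [q] spells the remaining letters. Summed over [a], the
   cross term of the square vanishes because [y 0] has zero sum. *)
rewrite (eq_bigr (fun q : 'I_(w ^ L) =>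
    \sum_(a < w) y 0%N a ^+ 2 + Z q ^+ 2 *+ w)); last first.
  move=> q _; rewrite (eq_bigr (fun a : 'I_w =>
      y 0%N a ^+ 2 + Z q ^+ 2 + y 0%N a * (Z q *+ 2))); last first.
    move=> a _; rewrite big_ord_recl /=.
    have -> : digit w (q * w + a) 0 = a.
      by rewrite /digit expn0 divn1 modnMDl modn_small.
    have -> : \sum_(l < L) y (bump 0 l) (digit w (q * w + a) (bump 0 l)) = Z q.
      apply: eq_bigr => l _; rewrite /digit /bump /= add1n expnS divnMA.
      by rewrite divnMDl// (divn_small (ltn_ord a)) addn0.
    by rewrite sqrrD addrAC mulrnAr.
  by rewrite !big_split /= sumr_const card_ord -mulr_suml y0 mul0r addr0.
rewrite big_split /= sumr_const card_ord mulrDl sumrMnl big_ord_recl mulrDr.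
have {}IH : (\sum_(q < w ^ L) Z q ^+ 2) * w%:R =
    (w ^ L)%:R * \sum_(l < L) \sum_(a < w) y l.+1 a ^+ 2.
  by apply: (IH (fun l => y l.+1)) => l; exact: y0.
rewrite [X in _ + X = _]mulrnAl IH -[_ *+ w ^ L]mulr_natr natrM /=.
by congr (_ + _); [rewrite -mulrA mulrC|rewrite -[_ *+ w]mulr_natr mulrAC].
Qed.

(** Abel summation: nonincreasing nonnegative weights reduce the sum to the partial sums of [b], so
    an upper bound on these suffices. *)
Lemma abel_sum_le (R : realDomainType) (b V : nat -> R) (C : R) K :
  0 <= C -> (forall k, 0 <= V k) -> (forall k, V k.+1 <= V k) ->
  (forall n, \sum_(k < n) b k <= C) -> \sum_(k < K) V k * b k <= C * V 0%N.
Proof.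
move=> C0 V0 Vd bC; case: K => [|K]; first by rewrite big_ord0 mulr_ge0.
suff: \sum_(k < K.+1) V k * b k <=
    V K * (\sum_(k < K.+1) b k) + C * (V 0%N - V K).
  move=> /le_trans; apply; have := ler_wpM2l (V0 K) (bC K.+1); lra.
elim: K => [|K IH]; first by rewrite !big_ord1; lra.
rewrite big_ord_recr [in leRHS]big_ord_recr /= mulrDr -addrA [_ + C * _]addrC.
rewrite addrA lerD2r; apply: le_trans IH _.
have : (V K - V K.+1) * (\sum_(k < K.+1) b k) <= (V K - V K.+1) * C.
  by rewrite ler_wpM2l// subr_ge0.
lra.
Qed.

Set Implicit Arguments.
Unset Strict Implicit.

Lemma sume_const (R : realType) k (y : \bar R) :
  (0 <= y)%E -> (\sum_(i < k) y = k%:R%:E * y)%E.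
Proof.
move=> y0; elim: k => [|k IH]; first by rewrite big_ord0 mul0e.
by rewrite big_ord_recr /= IH -natr1 EFinD ge0_muleDl ?lee_fin// mul1e.
Qed.

(** * Integrals of nonnegative real functions *)

Section nonneg_integral.
Context {d : measure_display} {X : measurableType d} {R : realType}.
Implicit Types (mu : probability X R) (f g : X -> R) (S : X -> X).

Definition nnmeas f := measurable_fun setT f /\ forall x, 0 <= f x.

Definition eint mu f : \bar R := (\int[mu]_x (f x)%:E)%E.

Lemma eint_ge0 mu f : (forall x, 0 <= f x) -> (0 <= eint mu f)%E.
Proof. by move=> f0; apply: integral_ge0 => x _; rewrite lee_fin. Qed.

Lemma eint_le mu f g : nnmeas f -> nnmeas g -> (forall x, f x <= g x) ->
  (eint mu f <= eint mu g)%E.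
Proof.
move=> [mf f0] [mg g0] fg; apply: ge0_le_integral => //.
- by move=> x _; rewrite lee_fin.
- exact/measurable_EFinP.
- exact/measurable_EFinP.
- by move=> x _; rewrite lee_fin.
Qed.

Lemma nnmeasD f g : nnmeas f -> nnmeas g -> nnmeas (fun x => f x + g x).
Proof.
move=> [mf f0] [mg g0]; split; first exact: measurable_funD.
by move=> x; rewrite addr_ge0.
Qed.

Lemma nnmeas_cst (c : R) : 0 <= c -> nnmeas (fun=> c).
Proof. by move=> c0; split => //; exact: measurable_cst. Qed.

Lemma nnmeasZ (c : R) f : 0 <= c -> nnmeas f -> nnmeas (fun x => c * f x).
Proof.
move=> c0 [mf f0]; split; last by move=> x; rewrite mulr_ge0.
by apply: measurable_funM => //; exact: measurable_cst.
Qed.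

Lemma nnmeas_sum n (h : nat -> X -> R) : (forall i, nnmeas (h i)) ->
  nnmeas (fun x => \sum_(i < n) h i x).
Proof.
move=> mh; split; last by move=> x; apply: sumr_ge0 => i _; have [_] := mh i.
by apply: measurable_sum => i; have [] := mh i.
Qed.

Lemma measurable_lt_set f g : measurable_fun setT f -> measurable_fun setT g ->
  measurable [set x | f x < g x].
Proof.
move=> mf mg; rewrite -[X in measurable X]setTI.
exact: (measurable_fun_ltr mf mg measurableT (Y := [set true])).
Qed.

Lemma nnmeas_sqr f : measurable_fun setT f -> nnmeas (fun x => f x ^+ 2).
Proof. by move=> mf; split; [exact: measurable_funX|move=> x; exact: sqr_ge0]. Qed.

Lemma nnmeas_norm f : measurable_fun setT f -> nnmeas (fun x => `|f x|).
Proof. by move=> mf; split => //; exact: measurableT_comp. Qed.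

Lemma eintD mu f g : nnmeas f -> nnmeas g ->
  (eint mu (fun x => f x + g x)%R = eint mu f + eint mu g)%E.
Proof.
move=> [mf f0] [mg g0]; rewrite /eint -ge0_integralD//;
  by [exact/measurable_EFinP|move=> x _; rewrite lee_fin].
Qed.

Lemma eintZ mu (c : R) f : 0 <= c -> nnmeas f ->
  (eint mu (fun x => c * f x)%R = c%:E * eint mu f)%E.
Proof.
move=> c0 [mf f0]; rewrite /eint -ge0_integralZl_EFin//;
  by [exact/measurable_EFinP|move=> x _; rewrite lee_fin].
Qed.

Lemma eint_sum mu n (h : nat -> X -> R) : (forall i, nnmeas (h i)) ->
  (eint mu (fun x => \sum_(i < n) h i x)%R = \sum_(i < n) eint mu (h i))%E.
Proof.
move=> mh; rewrite /eint.
under eq_integral do rewrite -sumEFin.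
rewrite ge0_integral_sum// => i; first by apply/measurable_EFinP; have [] := mh i.
by move=> x _; rewrite lee_fin; have [_] := mh i.
Qed.

Lemma eint_cst mu (c : R) : eint mu (fun=> c) = c%:E.
Proof. by rewrite /eint integral_cst// [X in (_ * X)%E]probability_setT mule1. Qed.

Lemma eint_indic mu (A : set X) : measurable A -> eint mu (\1_A) = mu A.
Proof. by move=> mA; rewrite /eint integral_indic// setIT. Qed.

Lemma nnmeas_indic (A : set X) : measurable A -> nnmeas (\1_A : X -> R).
Proof. by move=> mA; split => //; exact: measurable_indic. Qed.

(** * Measure-preserving maps and Borel-Cantelli *)

Definition mpreserving mu S := measurable_fun setT S /\
  forall A, measurable A -> mu (S @^-1` A) = mu A.

Lemma mpreserving_iter mu S n : mpreserving mu S -> mpreserving mu (iter n S).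
Proof.
move=> [mS pS]; elim: n => [|n [mI pI]]; first by split => //; exact: measurable_id.
split; first exact: (measurableT_comp mS mI).
move=> A mA; rewrite -(pS A mA) -(pI (S @^-1` A))//.
by rewrite -[X in measurable X]setTI; exact: mS.
Qed.

Lemma measurable_comp_mp mu S f : mpreserving mu S -> measurable_fun setT f ->
  measurable_fun setT (fun x => f (S x)).
Proof. by move=> [mS _] mf; exact: measurableT_comp. Qed.

Lemma nnmeas_comp mu S f : mpreserving mu S -> nnmeas f ->
  nnmeas (fun x => f (S x)).
Proof.
by move=> mS [mf f0]; split => //; exact: (measurable_comp_mp mS).
Qed.

Lemma eint_comp mu S f : mpreserving mu S -> nnmeas f ->
  eint mu (fun x => f (S x)) = eint mu f.
Proof.
move=> [mS pS] [mf f0]; rewrite /eint.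
have := @ge0_integral_pushforward _ _ _ _ R _ mS mu setT (EFin \o f) measurableT.
rewrite preimage_setT => <-.
- by apply: eq_measure_integral => A mA _; rewrite /= /pushforward pS.
- exact/measurable_EFinP.
- by move=> x _; rewrite /= lee_fin.
Qed.

Lemma borel_cantelli_ae mu (A : nat -> set X) (a : nat -> R) (C : R) :
  (forall i, measurable (A i)) -> (forall i, (mu (A i) <= (a i)%:E)%E) ->
  (forall n, \sum_(i < n) a i <= C) ->
  {ae mu, forall x, exists i0, forall i, (i0 <= i)%N -> ~ A i x}.
Proof.
move=> mA Aa aC; have h : mu (lim_sup_set A) = 0%E.
  apply: lim_sup_set_cvg0 => //; apply: (@le_lt_trans _ _ C%:E); last exact: ltry.
  apply: lime_le; first exact: is_cvg_nneseries.
  apply: nearW => n; apply: (@le_trans _ _ (\sum_(i < n) a i)%:E); last first.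
    by rewrite lee_fin.
  by rewrite big_mkord -sumEFin; apply: lee_sum => i _; exact: Aa.
exists (lim_sup_set A); split => //.
  apply: bigcap_measurable => // k _; exact: bigcup_measurable.
move=> x /= hx n _; apply: contra_notP hx => hn; exists n => i ni Ai.
by apply: hn; exists i.
Qed.

(** * Birkhoff sums and the maximal ergodic inequality *)

Definition bsum S f (n : nat) (x : X) : R := \sum_(k < n) f (iter k S x).

Lemma bsumS S f n x : bsum S f n.+1 x = f x + bsum S f n (S x).
Proof.
rewrite /bsum big_ord_recl /=; congr (_ + _).
by apply: eq_bigr => k _; rewrite -iterS iterSr.
Qed.

Lemma measurable_bsum mu S f n : mpreserving mu S -> measurable_fun setT f ->
  measurable_fun setT (bsum S f n).
Proof.
move=> mS mf; apply: measurable_sum => k.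
exact: (measurable_comp_mp (mpreserving_iter k mS)).
Qed.

(* [garsia S f c N x] is the maximum over [n <= N] of [bsum S f n x - c n]. *)
Fixpoint garsia S f (c : R) N x : R :=
  if N is N'.+1 then Num.max 0 (f x - c + garsia S f c N' (S x)) else 0.

Lemma garsia_ge0 S f c N x : 0 <= garsia S f c N x.
Proof. by case: N => [//|N] /=; rewrite le_max lexx. Qed.

Lemma garsiaS S f c N x : garsia S f c N x <= garsia S f c N.+1 x.
Proof.
elim: N x => [|N IH] x; first exact: garsia_ge0.
by rewrite [garsia _ _ _ N.+1 _]/= [leRHS]/= ge_max !le_max lexx /= lerD2l IH orbT.
Qed.

Lemma garsia_ge S f c N n x : (n <= N)%N ->
  bsum S f n x - c * n%:R <= garsia S f c N x.
Proof.
elim: N n x => [|N IH] [|n] x nN //.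
- by rewrite /bsum big_ord0 mulr0 subr0.
- by rewrite /bsum big_ord0 mulr0 subr0 garsia_ge0.
- rewrite /= le_max; apply/orP; right; rewrite bsumS -natr1.
  have := IH n (S x) nN; lra.
Qed.

Lemma measurable_garsia mu S f c N : mpreserving mu S -> measurable_fun setT f ->
  measurable_fun setT (garsia S f c N).
Proof.
move=> mS mf; elim: N => [|N IH] /=; first exact: measurable_cst.
apply: measurable_maxr; first exact: measurable_cst.
apply: measurable_funD; last exact: (measurable_comp_mp mS).
by apply: measurable_funB => //; exact: measurable_cst.
Qed.

Lemma garsia_le_bsum S f c N x : 0 <= c -> (forall x, 0 <= f x) ->
  garsia S f c N x <= bsum S f N x.
Proof.
move=> c0 f0; elim: N x => [|N IH] x; first by rewrite /bsum big_ord0.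
rewrite /= ge_max; apply/andP; split; first by apply: sumr_ge0.
by rewrite bsumS; have := IH (S x); lra.
Qed.

Lemma eint_bsum mu S f n : mpreserving mu S -> nnmeas f ->
  eint mu (bsum S f n) = (n%:R%:E * eint mu f)%E.
Proof.
move=> mS mf; rewrite /eint /bsum.
rewrite -[LHS]/(eint mu (fun x => \sum_(k < n) (fun k x => f (iter k S x)) k x)).
rewrite eint_sum; last by move=> k; exact: (nnmeas_comp (mpreserving_iter k mS) mf).
rewrite (eq_bigr (fun=> eint mu f)); last first.
  by move=> k _; exact: (eint_comp (mpreserving_iter k mS) mf).
by rewrite sume_const//; apply: eint_ge0; case: mf.
Qed.

(** Garsia's argument: where the maximum [M] is positive, [c + M <= f + M \o S]; elsewhere [M = 0]
    and the right side is nonnegative. Integrate and cancel the integral of [M], which is finite and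
    equals that of [M \o S]. *)
Lemma garsia_ineq mu S f (c : R) N : mpreserving mu S -> nnmeas f ->
  (eint mu f < +oo)%E -> 0 <= c ->
  (c%:E * mu [set x | 0 < garsia S f c N x]%R <= eint mu f)%E.
Proof.
move=> mS mf fi c0; set M := garsia S f c N.
have nM : nnmeas M.
  by split; [apply: (measurable_garsia c N mS); case: mf|exact: garsia_ge0].
have Mfin : (eint mu M < +oo)%E.
  apply: (@le_lt_trans _ _ (eint mu (bsum S f N))); last first.
    by rewrite eint_bsum// lte_mul_pinfty.
  apply: eint_le => //.
    split; first by apply: (measurable_bsum N mS); case: mf.
    by move=> x; apply: sumr_ge0 => k _; case: mf.
  by move=> x; apply: garsia_le_bsum => //; case: mf.
have mE : measurable [set x | 0 < M x].
  by apply: measurable_lt_set; [exact: measurable_cst|case: nM].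
rewrite -(eint_indic mu mE) -eintZ//.
have Mfn : eint mu M \is a fin_num.
  by rewrite ge0_fin_numE//; apply: eint_ge0; case: nM.
have nE : nnmeas (fun x => c * \1_[set x | 0 < M x] x).
  by apply: nnmeasZ => //; exact: (nnmeas_indic mE).
have nMS := nnmeas_comp mS nM.
rewrite -(leeD2rE (eint mu (fun x => c * \1_[set x | 0 < M x] x)) (eint mu f) Mfn).
rewrite -{2}(eint_comp mS nM) -!eintD//.
apply: eint_le => [||x]; [exact: nnmeasD|exact: nnmeasD|].
rewrite indicE; have [Mx|] := boolP (0 < M x); last first.
  rewrite -leNgt => Mx; rewrite memNset /=; last by rewrite ltNge Mx.
  rewrite mulr0 add0r (le_trans Mx)// addr_ge0//; [by case: mf|by case: nMS].
rewrite mem_set// mulr1; move: Mx; rewrite /M; case: (N) => [|N'] /=.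
  by rewrite ltxx.
rewrite lt_max ltxx /= => Mx.
have := garsiaS S f c N' (S x); rewrite (max_r (ltW Mx)) /=; lra.
Qed.

(** The sets of [garsia_ineq] increase with [N] and their union contains the set here; continuity
    from below passes to the limit. *)
Lemma maximal_ergodic mu S f (c : R) : mpreserving mu S -> nnmeas f ->
  (eint mu f < +oo)%E -> 0 <= c ->
  measurable [set x | exists n, c * n%:R < bsum S f n x] /\
  (c%:E * mu [set x | exists n, c * n%:R < bsum S f n x]%R <= eint mu f)%E.
Proof.
move=> mS mf fi c0; set A := [set x | _].
have mA : measurable A.
  have -> : A = \bigcup_n [set x | c * n%:R < bsum S f n x].
    by apply/seteqP; split=> x /= [n]; [exists n|exists n].
  apply: bigcupT_measurable => n; apply: measurable_lt_set.
    exact: measurable_cst.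
  by apply: (measurable_bsum n mS); case: mf.
split=> //; pose E N := [set x | 0 < garsia S f c N x].
have mE N : measurable (E N).
  apply: measurable_lt_set; first exact: measurable_cst.
  by apply: (measurable_garsia c N mS); case: mf.
have mU : measurable (\bigcup_N E N) by exact: bigcupT_measurable.
have ndE : nondecreasing_seq E.
  apply/nondecreasing_seqP => N; apply/subsetPset => x /= h.
  exact: lt_le_trans h (garsiaS S f c N x).
apply: (@le_trans _ _ (c%:E * mu (\bigcup_N E N))%E).
  apply: lee_wpmul2l; first by rewrite lee_fin.
  rewrite le_measure ?inE// => x [n hn]; exists n => //=.
  by apply: lt_le_trans (garsia_ge S f c x (leqnn n)); rewrite subr_gt0.
have h : (c%:E * (mu \o E) N)%E @[N --> \oo] --> (c%:E * mu (\bigcup_N E N))%E.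
  by apply: cvgeZl => //; exact: nondecreasing_cvg_mu.
rewrite -(cvg_lim _ h)//; apply: lime_le; first by apply/cvg_ex; eexists; exact: h.
by apply: nearW => N; exact: garsia_ineq.
Qed.

End nonneg_integral.

(** * Two inequalities for sums of squares *)

Lemma sqr_sum_le (R : realDomainType) n (z : nat -> R) :
  (\sum_(q < n) z q) ^+ 2 <= n%:R * \sum_(q < n) z q ^+ 2.
Proof.
case: n => [|n]; first by rewrite !big_ord0 expr0n mul0r.
set s := \sum_(q < _) z q; set Q := \sum_(q < _) _; set m := n.+1%:R.
(* This sum equals [m * (m * Q - s ^+ 2)], which yields Cauchy-Schwarz after cancelling [m]. *)
have : 0 <= \sum_(q < n.+1) (m * z q - s) ^+ 2.
  by apply: sumr_ge0 => q _; exact: sqr_ge0.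
rewrite (eq_bigr (fun q : 'I_n.+1 =>
    m ^+ 2 * z q ^+ 2 - (m * s *+ 2) * z q + s ^+ 2)); last first.
  by move=> q _; ring.
rewrite !big_split /= sumr_const card_ord sumrN -!mulr_sumr -/s -/Q.
rewrite -[s ^+ 2 *+ _]mulr_natl -/m.
have -> : m ^+ 2 * Q - (m * s *+ 2) * s + m * s ^+ 2 = m * (m * Q - s ^+ 2) by ring.
by rewrite pmulr_rge0 ?subr_ge0// /m ltr0n.
Qed.

(** Centring at the mean [m] lowers the sum of squares by exactly [n * m ^+ 2]. *)
Lemma sqr_dev_le (R : realFieldType) n (z : nat -> R) : (0 < n)%N ->
  \sum_(a < n) (z a - n%:R^-1 * \sum_(b < n) z b) ^+ 2 <= \sum_(a < n) z a ^+ 2.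
Proof.
move=> n0; set m := n%:R^-1 * _.
rewrite (eq_bigr (fun a : 'I_n =>
    z a ^+ 2 - (m *+ 2) * z a + m ^+ 2)); last by move=> q _; ring.
rewrite !big_split /= sumr_const card_ord sumrN -!mulr_sumr.
have -> : \sum_(a < n) z a = n%:R * m by rewrite /m mulVKf// pnatr_eq0 -lt0n.
have : 0 <= n%:R * m ^+ 2 by rewrite mulr_ge0// sqr_ge0.
rewrite -[_ *+ n]mulr_natl; lra.
Qed.

(** * The upper half of the pointwise ergodic theorem *)

Section birkhoff.
Context {d : measure_display} {X : measurableType d} {R : realType}.
Implicit Types (mu : probability X R) (f g : X -> R) (S : X -> X).

(** The set where [bsum S f n x - c * n] is unbounded above in [n] is invariant; if it had measure
    one, the maximal inequality would give [c <= eint mu f]. *)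
Lemma birkhoff_upper mu S f (c : R) : mpreserving mu S -> ergodic mu S ->
  nnmeas f -> (eint mu f < c%:E)%E ->
  {ae mu, forall x, exists C, forall n, bsum S f n x <= C + c * n%:R}.
Proof.
move=> mS eS mf fc; have [f_meas f0] := mf.
have c0 : 0 < c by rewrite -lte_fin; apply: le_lt_trans fc; exact: eint_ge0.
pose A := [set x | forall m : nat, exists n, m%:R + c * n%:R < bsum S f n x].
have mA : measurable A.
  have -> : A = \bigcap_m \bigcup_n [set x | m%:R + c * n%:R < bsum S f n x].
    apply/seteqP; split=> x /=; first by move=> h m _; have [n] := h m; exists n.
    by move=> h m; have [n] := h m I; exists n.
  apply: bigcapT_measurable => m; apply: bigcupT_measurable => n.
  apply: measurable_lt_set; first exact: measurable_cst.
  exact: (measurable_bsum n mS).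
(* Passing between [x] and [S x] changes the deviation by [f x] and [c] only, which a larger [m]
   absorbs. *)
have SA : S @^-1` A = A.
  apply/seteqP; split=> x /= h m.
    have [n h1] := h (m + (Num.truncn c).+1)%N; exists n.+1.
    rewrite bsumS -[n.+1%:R]natr1.
    by move: h1; rewrite natrD; have := truncnS_gt c; have := f0 x; lra.
  have [[|n]] := h (m + (Num.truncn (f x)).+1)%N.
    by rewrite /bsum big_ord0 mulr0 addr0 ltrn0.
  rewrite bsumS -[n.+1%:R]natr1 natrD => b; exists n.
  by have := truncnS_gt (f x); lra.
have A0 : mu A = 0%E.
  have [//|A1] := eS A mA SA.
  have [mB] := maximal_ergodic mS mf (lt_trans fc (ltry _)) (ltW c0).
  set B := [set x | _] => cB.
  suff : (c%:E <= c%:E * mu B)%E.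
    by move=> /le_trans /(_ cB); rewrite leNgt fc.
  rewrite -{1}[c%:E]mule1 -A1; apply: lee_wpmul2l; first by rewrite lee_fin ltW.
  rewrite le_measure ?inE// => x /(_ 0%N)[n]; rewrite add0r => h.
  by exists n.
exists A; split=> // x /= h m; apply: contra_notP h => h.
by exists m%:R => n; rewrite leNgt; apply: contra_notN h => ?; exists n.
Qed.

(** * One period compared with its windows, in mean square and in mean *)

Definition block_sum w L cl S f (x : X) : R :=
  \sum_(r < L * w ^ L) f (iter (r * cl + digit w (r %/ L) (r %% L)) S x).

Definition window_sum w L cl S f (x : X) : R :=
  \sum_(r < L * w ^ L) w%:R^-1 * \sum_(b < w) f (iter (r * cl + b) S x).

(** Centred in the letter [a]: for each [l] the values over [a < w] sum to zero, as [sum_words_sqr]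
    requires. *)
Let dev w cl S f (x : X) (l a : nat) : R :=
  f (iter (l * cl + a) S x) - w%:R^-1 * \sum_(b < w) f (iter (l * cl + b) S x).

Lemma block_sub_window w L cl S f x : (0 < L)%N ->
  block_sum w L cl S f x - window_sum w L cl S f x =
  \sum_(q < w ^ L) \sum_(l < L)
    dev w cl S f (iter (q * L * cl) S x) l (digit w q l).
Proof.
move=> L0; rewrite /block_sum /window_sum -sumrB mulnC.
rewrite (sum_blocks _ (fun r => f (iter (r * cl + digit w (r %/ L) (r %% L)) S x) -
  w%:R^-1 * \sum_(b < w) f (iter (r * cl + b) S x))).
apply: eq_bigr => q _; apply: eq_bigr => l _.
rewrite divnMDl// divn_small// addn0 modnMDl modn_small// /dev.
have E a : iter (l * cl + a) S (iter (q * L * cl) S x) =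
    iter ((q * L + l) * cl + a) S x.
  by rewrite -iterD; congr (iter _ S x); lia.
rewrite E; congr (_ - _ * _); apply: eq_bigr => b _; by rewrite E.
Qed.

Lemma measurable_dev mu w cl S f l a : mpreserving mu S ->
  measurable_fun setT f -> measurable_fun setT (fun x => dev w cl S f x l a).
Proof.
move=> mS mf.
have mi n : measurable_fun setT (fun x => f (iter n S x)).
  exact: (measurable_comp_mp (mpreserving_iter n mS)).
apply: measurable_funB; first exact: mi.
apply: measurable_funM; first exact: measurable_cst.
by apply: measurable_sum => b; exact: mi.
Qed.

Lemma measurable_block_sub_window mu w L cl S f : mpreserving mu S ->
  measurable_fun setT f ->
  measurable_fun setT (fun x => block_sum w L cl S f x - window_sum w L cl S f x).
Proof.
move=> mS mf.
have mi n : measurable_fun setT (fun x => f (iter n S x)).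
  exact: (measurable_comp_mp (mpreserving_iter n mS)).
apply: measurable_funB; apply: measurable_sum => r; first exact: mi.
apply: measurable_funM; first exact: measurable_cst.
by apply: measurable_sum => b; exact: mi.
Qed.

(** Divided by the square of the period length [L * w ^ L], the bound is the squared [L^2] norm of
    [f] over [L]: orthogonality of the letters gains the factor [L]. *)
Lemma eint_block_sub_window_sqr mu w L cl S f : (0 < w)%N -> (0 < L)%N ->
  mpreserving mu S -> nnmeas f ->
  (eint mu (fun x => (block_sum w L cl S f x - window_sum w L cl S f x) ^+ 2)%R <=
   (L%:R * (w ^ L)%:R ^+ 2)%:E * eint mu (fun x => f x ^+ 2)%R)%E.
Proof.
move=> w0 L0 mS [mf f0]; set n := (w ^ L)%N.
have w0R : 0 < w%:R :> R by rewrite ltr0n.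
pose Z q x := \sum_(l < L) dev w cl S f x l (digit w q l).
have mZ q : measurable_fun setT (Z q).
  by apply: measurable_sum => l; exact: (measurable_dev _ _ _ _ mS).
have mZi q : nnmeas (fun x => Z q (iter (q * L * cl) S x) ^+ 2).
  exact: (nnmeas_comp (mpreserving_iter (q * L * cl) mS) (nnmeas_sqr (mZ q))).
have mf2 : nnmeas (fun x => f x ^+ 2) by exact: nnmeas_sqr.
have mfi k : nnmeas (fun x => f (iter k S x) ^+ 2).
  exact: (nnmeas_comp (mpreserving_iter k mS) mf2).
have n0 : 0 <= n%:R :> R by [].
(* Cauchy-Schwarz over the [n] words; invariance then moves every [Z q] to the same base point. *)
apply: (@le_trans _ _
    (n%:R%:E * (\sum_(q < n) eint mu (fun x => Z q x ^+ 2)%R))%E).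
  apply: (@le_trans _ _ (eint mu (fun x =>
      n%:R * \sum_(q < n) Z q (iter (q * L * cl) S x) ^+ 2)%R)).
    apply: eint_le.
    - by apply: nnmeas_sqr; exact: (measurable_block_sub_window _ _ _ mS).
    - apply: nnmeasZ => //.
      exact: (nnmeas_sum n (h := fun q x => Z q (iter (q * L * cl) S x) ^+ 2)).
    - move=> x; rewrite block_sub_window//.
      exact: (sqr_sum_le n (fun q => Z q (iter (q * L * cl) S x))).
  rewrite eintZ//; last first.
    exact: (nnmeas_sum n (h := fun q x => Z q (iter (q * L * cl) S x) ^+ 2)).
  apply: lee_wpmul2l; first by rewrite lee_fin.
  rewrite (@eint_sum _ _ _ mu n (fun q x => Z q (iter (q * L * cl) S x) ^+ 2))//.
  apply: lee_sum => q _.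
  rewrite (eint_comp (mpreserving_iter (q * L * cl) mS) (f := fun x => Z q x ^+ 2))//.
  exact: nnmeas_sqr.
rewrite -(@eint_sum _ _ _ mu n (fun q x => Z q x ^+ 2)); last first.
  by move=> q; exact: nnmeas_sqr.
pose sq x : R := \sum_(l < L) \sum_(a < w) f (iter (l * cl + a) S x) ^+ 2.
have msq : nnmeas sq.
  apply: (nnmeas_sum L (h := fun l x => \sum_(a < w) f (iter (l * cl + a) S x) ^+ 2)).
  move=> l; exact: (nnmeas_sum w (h := fun a x => f (iter (l * cl + a) S x) ^+ 2)).
have sqE : eint mu sq = ((L%:R * w%:R)%:E * eint mu (fun x => f x ^+ 2)%R)%E.
  rewrite (@eint_sum _ _ _ mu L (fun l x => \sum_(a < w) f (iter (l * cl + a) S x) ^+ 2));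
    last by move=> l;
      exact: (nnmeas_sum w (h := fun a x => f (iter (l * cl + a) S x) ^+ 2)).
  rewrite (eq_bigr (fun=> w%:R%:E * eint mu (fun x => f x ^+ 2)%R))%E; last first.
    move=> l _; rewrite (@eint_sum _ _ _ mu w (fun a x => f (iter (l * cl + a) S x) ^+ 2))//.
    rewrite (eq_bigr (fun=> eint mu (fun x => f x ^+ 2)%R)).
      by rewrite sume_const// eint_ge0; case: mf2.
    move=> a _; exact: (eint_comp (mpreserving_iter _ mS) mf2).
  rewrite sume_const; last by rewrite mule_ge0 ?lee_fin ?eint_ge0//; case: mf2.
  by rewrite EFinM muleA.
(* At a common base point the sum over all words leaves only the squares of [dev], and centring does
   not increase squares. *)
apply: (@le_trans _ _ (n%:R%:E * (n%:R / w%:R)%:E * eint mu sq)%E).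
  rewrite -muleA; apply: lee_wpmul2l; first by rewrite lee_fin.
  rewrite -eintZ ?divr_ge0//; apply: eint_le.
  - by apply: (nnmeas_sum n (h := fun q x => Z q x ^+ 2)) => q; exact: nnmeas_sqr.
  - by apply: nnmeasZ => //; rewrite divr_ge0.
  - move=> x; rewrite mulrAC ler_pdivlMr// sum_words_sqr//; last first.
      move=> l; rewrite /dev sumrB sumr_const card_ord -[_ *+ w]mulr_natl.
      by rewrite mulVKf ?subrr// gt_eqF.
    apply: ler_wpM2l => //; apply: ler_sum => l _.
    exact: (sqr_dev_le (fun a => f (iter (l * cl + a) S x))).
rewrite sqE !muleA -!EFinM.
rewrite (_ : n%:R * (n%:R / w%:R) * (L%:R * w%:R) = L%:R * n%:R ^+ 2)//.
by field; rewrite gt_eqF.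
Qed.

(** From [L^2] to [L^1] by [u <= b + u ^+ 2 / b] pointwise, the integral of [f ^+ 2] being at most
    [t * e]. The free [b] becomes [1 / 2 ^ i] in phase [i]. *)
Lemma eint_block_sub_window mu w L cl S f (t b e : R) : (0 < w)%N -> (0 < L)%N ->
  mpreserving mu S -> nnmeas f -> 0 <= t -> (forall x, f x <= t) -> 0 < b ->
  (eint mu f <= e%:E)%E ->
  (eint mu (fun x => (L * w ^ L)%:R^-1 *
     `|block_sum w L cl S f x - window_sum w L cl S f x|)%R
   <= (b + t * e / (b * L%:R))%:E)%E.
Proof.
move=> w0 L0 mS mf t0 ft b0 fe; have [f_meas f0] := mf.
set D := fun x => block_sum w L cl S f x - window_sum w L cl S f x.
have mD : measurable_fun setT D by exact: (measurable_block_sub_window _ _ _ mS).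
set s := (L * w ^ L)%:R.
have s0 : 0 < s :> R by rewrite ltr0n muln_gt0 L0 expn_gt0 w0.
have n0 : 0 < (w ^ L)%:R :> R by rewrite ltr0n expn_gt0 w0.
have L0R : 0 < L%:R :> R by rewrite ltr0n.
have k0 : 0 <= (b * s ^+ 2)^-1 by rewrite invr_ge0 mulr_ge0 ?sqr_ge0// ltW.
apply: (@le_trans _ _ (eint mu (fun x => b + (b * s ^+ 2)^-1 * D x ^+ 2)%R)).
  apply: eint_le.
  - by apply: nnmeasZ; [rewrite invr_ge0 ltW|exact: nnmeas_norm].
  - apply: nnmeasD; first exact/nnmeas_cst/ltW.
    by apply: nnmeasZ => //; exact: nnmeas_sqr.
  - move=> x; rewrite -(real_normK (num_real (D x))).
    move: `|D x| (normr_ge0 (D x)) => z z0.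
    have -> : (b * s ^+ 2)^-1 * z ^+ 2 = b^-1 * (s^-1 * z) ^+ 2.
      by field; rewrite (gt_eqF n0) (gt_eqF L0R) (gt_eqF b0).
    move: (s^-1 * z) => u.
    rewrite -(ler_pM2l b0) mulrDr mulVKf ?gt_eqF//.
    have := sqr_ge0 (u - b); have := sqr_ge0 u; have := sqr_ge0 b; lra.
rewrite eintD; last 2 first.
- exact/nnmeas_cst/ltW.
- by apply: nnmeasZ => //; exact: nnmeas_sqr.
rewrite eint_cst EFinD; apply: leeD => //.
rewrite eintZ//; last exact: nnmeas_sqr.
have h1 : (eint mu (fun x => f x ^+ 2)%R <= (t * e)%:E)%E.
  rewrite EFinM; apply: (@le_trans _ _ (t%:E * eint mu f)%E); last first.
    by apply: lee_wpmul2l => //; rewrite lee_fin.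
  rewrite -eintZ//; apply: eint_le; [exact: nnmeas_sqr|exact: nnmeasZ|].
  by move=> x; rewrite expr2 ler_wpM2r.
apply: (@le_trans _ _ ((b * s ^+ 2)^-1%:E * ((L%:R * (w ^ L)%:R ^+ 2)%:E * (t * e)%:E))%E).
  apply: lee_wpmul2l; first by rewrite lee_fin.
  apply: le_trans (eint_block_sub_window_sqr cl w0 L0 mS mf) _.
  by apply: lee_wpmul2l => //; rewrite lee_fin mulr_ge0// sqr_ge0.
rewrite -!EFinM lee_fin /s natrM.
rewrite le_eqVlt; apply/orP; left; apply/eqP; field.
by rewrite (gt_eqF n0) (gt_eqF L0R) (gt_eqF b0).
Qed.
End birkhoff.

Lemma sum_le_affine (R : realDomainType) (z : nat -> R) (b : R) m n :
  (forall k, 0 <= z k) -> 0 <= b -> (forall k, (m <= k)%N -> z k <= b) ->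
  \sum_(k < n) z k <= \sum_(k < m) z k + b * n%:R.
Proof.
move=> z0 b0 zb; elim: n => [|n IH].
  by rewrite big_ord0 mulr0 addr0 sumr_ge0.
have [mn|nm] := leqP m n.
  by rewrite big_ord_recr /= -natr1; have := zb _ mn; lra.
rewrite -(subnKC nm) [X in _ <= X + _]big_split_ord /= -addrA lerDl addr_ge0//.
  exact: sumr_ge0.
by rewrite mulr_ge0.
Qed.

(** * Pointwise estimates along the sequence *)

Section deterministic.
Context {d : measure_display} {X : measurableType d} {R : realType} (T : X -> X).
Implicit Types (f g : X -> R).

Definition phase_block i f := block_sum (window i) (wlen i) (cell i) T f.
Definition phase_window i f := window_sum (window i) (wlen i) (cell i) T f.
Definition pshift i : nat := plen i * cell i.

Lemma sum_phase i N f x : (start i + N * plen i <= start i.+1)%N ->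
  \sum_(k < N * plen i) f (iter (seqn (start i + k)) T x) =
  \sum_(q < N) phase_block i f (iter (q * pshift i) T (iter (pos (start i)) T x)).
Proof.
move=> h; rewrite (sum_blocks _ (fun k => f (iter (seqn (start i + k)) T x))).
apply: eq_bigr => q _; rewrite /phase_block /block_sum; apply: eq_bigr => r _.
have rs : (r < plen i)%N by exact: ltn_ord.
have qN := ltn_ord q.
rewrite addnA seqn_block//; last first.
  apply: leq_trans h; rewrite -addnA ltn_add2l.
  apply: (@leq_trans (q.+1 * plen i)); first by rewrite mulSnr ltn_add2l.
  by rewrite leq_mul2r qN orbT.
by rewrite -!iterD /pshift addnC (addnC (pos _)) addnA.
Qed.

(** The window average with the window enlarged to the whole cell. Cells tile the time axis, so
    these add up to a Birkhoff sum with nonincreasing weights. *)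
Definition spread f k x : R :=
  (window (phase k))%:R^-1 * \sum_(a < cell (phase k)) f (iter (pos k + a) T x).

Lemma spread_ge0 f k x : (forall x, 0 <= f x) -> 0 <= spread f k x.
Proof. by move=> f0; rewrite mulr_ge0 ?invr_ge0// sumr_ge0. Qed.

Lemma sum_phase_window_le i N f x : (forall x, 0 <= f x) ->
  (start i + N * plen i <= start i.+1)%N ->
  \sum_(q < N) phase_window i f (iter (q * pshift i) T (iter (pos (start i)) T x)) <=
  \sum_(k < N * plen i) spread f (start i + k) x.
Proof.
move=> f0 h; rewrite (sum_blocks _ (fun k => spread f (start i + k) x)).
apply: ler_sum => q _; rewrite /phase_window /window_sum; apply: ler_sum => r _.
have rs : (r < plen i)%N by exact: ltn_ord.
have qN := ltn_ord q.
have qr : (start i + (q * plen i + r) < start i.+1)%N.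
  apply: leq_trans h; rewrite ltn_add2l.
  apply: (@leq_trans (q.+1 * plen i)); first by rewrite mulSnr ltn_add2l.
  by rewrite leq_mul2r qN orbT.
rewrite /spread (phaseE i) ?leq_addr// ler_wpM2l ?invr_ge0// posD ?(ltnW qr)//.
rewrite cellE big_split_ord /=; apply: ler_wpDr; first exact: sumr_ge0.
apply: ler_sum => b _; rewrite -!iterD /pshift le_eqVlt; apply/orP; left.
apply/eqP; congr (f (iter _ T x)).
by rewrite mulnDl -mulnA (addnA (pos _)) -[RHS]addnA [RHS]addnC (addnC (pos _)) addnA -cellE.
Qed.

Lemma sum_cells f K x :
  \sum_(k < K) \sum_(a < cell (phase k)) f (iter (pos k + a) T x) =
  bsum T f (pos K) x.
Proof.
elim: K => [|K IH]; first by rewrite /bsum /pos !big_ord0.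
rewrite big_ord_recr /= IH posS /bsum big_split_ord /=; congr (_ + _).
Qed.

Lemma window_cell i : (window i)%:R^-1 * (cell i)%:R = 1 + i.+1%:R^-1 :> R.
Proof.
rewrite /window /cell natrX natrM -[i.+2%:R]natr1.
have : i.+1%:R != 0 :> R by rewrite pnatr_eq0.
by move: i.+1%:R => a a0; field.
Qed.

(** Abel summation with weights [1 / window]: the centred cell sums have partial sums at most [C].
    What remains is the ratio of cell to window, at most 2, and at most [1 + 1 / (phase m).+1] from
    index [m] on. *)
Lemma sum_spread_le f (C c : R) m K x : 0 <= c ->
  (forall n, bsum T f n x <= C + c * n%:R) ->
  \sum_(k < K) spread f k x <=
    C + c * (m.*2%:R + (1 + (phase m).+1%:R^-1) * K%:R).
Proof.
move=> c0 fC; have C0 : 0 <= C.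
  by have := fC 0%N; rewrite /bsum big_ord0 mulr0 addr0.
pose V k : R := (window (phase k))%:R^-1.
pose F k := \sum_(a < cell (phase k)) f (iter (pos k + a) T x).
have -> : \sum_(k < K) spread f k x =
    \sum_(k < K) V k * (F k - c * (cell (phase k))%:R) +
    c * \sum_(k < K) (1 + (phase k).+1%:R^-1).
  rewrite mulr_sumr -big_split /=; apply: eq_bigr => k _.
  by rewrite /spread -/(V k) -/(F k) -window_cell -/(V k); ring.
apply: lerD.
  have V01 : C * V 0%N <= C
    by rewrite ler_piMr// /V invf_le1 ?ler1n ?ltr0n window_gt0.
  apply: le_trans V01.
  apply: (abel_sum_le R (fun k => F k - c * (cell (phase k))%:R) V C K) => // [k|k|n].
  - by rewrite /V invr_ge0.
  - rewrite /V lef_pV2 ?posrE ?ltr0n ?window_gt0// ler_nat /window leq_exp2r//.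
    by rewrite ltnS phase_mono.
  - rewrite sumrB sum_cells -mulr_sumr -natr_sum lerBlDr; exact: fC.
apply: ler_wpM2l => //.
apply: le_trans (@sum_le_affine _ (fun k => 1 + (phase k).+1%:R^-1)
  (1 + (phase m).+1%:R^-1) m K _ _ _) _ => [k||k mk|].
- by rewrite addr_ge0 ?invr_ge0.
- by rewrite addr_ge0 ?invr_ge0.
- by rewrite lerD2l lef_pV2 ?posrE ?ltr0n// ler_nat ltnS phase_mono.
rewrite lerD2r; apply: (@le_trans _ _ (\sum_(k < m) 2)); last first.
  by rewrite sumr_const card_ord -[_ *+ _]mulr_natr -natrM mul2n.
apply: ler_sum => k _; rewrite -[2]/(1 + 1) lerD2l invf_le1 ?ltr0n//.
by rewrite ler1n.
Qed.

(** * Splitting the function within a phase, and the resulting bound on averages *)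

Definition low_part f i x : R := if f x <= (cutoff i)%:R then f x else 0.
Definition mid_part f i x : R :=
  if (cutoff i)%:R < f x <= (start i.+1)%:R then f x else 0.

(** Bounds the error per term when one period is replaced by its windows; for [f >= 0] it is
    nonnegative, so the maximal inequality applies to it. *)
Definition fluctuation f i x : R :=
  (plen i)%:R^-1 * phase_block i (mid_part f i) x +
  (plen i)%:R^-1 * `|phase_block i (low_part f i) x - phase_window i (low_part f i) x|.

(* In phase i, [f = mid_part + low_part] along the sequence. *)
Lemma phase_bound f i N (eta : R) x : (forall x, 0 <= f x) ->
  (start i + N * plen i <= start i.+1)%N ->
  (forall k, (start i <= k < start i.+1)%N -> f (iter (seqn k) T x) <= k.+1%:R) ->
  bsum (iter (pshift i) T) (fluctuation f i) N (iter (pos (start i)) T x) <=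
    eta * N%:R ->
  \sum_(k < N * plen i) f (iter (seqn (start i + k)) T x) <=
  \sum_(k < N * plen i) (eta + spread f (start i + k) x).
Proof.
move=> f0 h fk; rewrite /bsum.
rewrite (eq_bigr (fun q : 'I_N =>
    fluctuation f i (iter (q * pshift i) T (iter (pos (start i)) T x)))); last first.
  by move=> q _; rewrite iterM.
move=> hb; have p0 : 0 < (plen i)%:R :> R by rewrite ltr0n plen_gt0.
pose y q := iter (q * pshift i) T (iter (pos (start i)) T x).
have -> : \sum_(k < N * plen i) f (iter (seqn (start i + k)) T x) =
    \sum_(q < N) phase_block i (mid_part f i) (y q) +
    \sum_(q < N) phase_block i (low_part f i) (y q).
  rewrite -!sum_phase// -big_split /=; apply: eq_bigr => k _.
  have kk : (start i <= start i + k < start i.+1)%N.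
    by rewrite leq_addr (leq_trans _ h)// ltn_add2l.
  have := fk _ kk; rewrite /mid_part /low_part; set v := f _ => vk.
  have -> : v <= (start i.+1)%:R.
    by apply: le_trans vk _; rewrite ler_nat; case/andP: kk.
  by rewrite andbT ltNge; case: (v <= _); rewrite ?addr0 ?add0r.
(* Only [low_part] is compared with its windows; [mid_part] is charged to the fluctuation in
   full. *)
apply: (@le_trans _ _ (\sum_(q < N) (plen i)%:R * fluctuation f i (y q) +
    \sum_(q < N) phase_window i (low_part f i) (y q))).
  rewrite -!big_split /=; apply: ler_sum => q _.
  rewrite /fluctuation mulrDr !mulVKf ?gt_eqF// -addrA lerD2l.
  by rewrite -lerBlDr ler_norm.
rewrite [leRHS]big_split /=; apply: lerD.
  rewrite -mulr_sumr sumr_const card_ord mulrnA -[leRHS]mulr_natl.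
  by rewrite ler_wpM2l// (le_trans hb)// mulr_natr.
apply: le_trans (sum_phase_window_le x f0 h).
apply: ler_sum => q _; rewrite /phase_window /window_sum; apply: ler_sum => r _.
rewrite ler_wpM2l ?invr_ge0//; apply: ler_sum => b _.
by rewrite /low_part; case: ifP.
Qed.

Lemma chain_bound f i0 (eta : R) x : (forall x, 0 <= f x) -> 0 <= eta ->
  (forall k, (start i0 <= k)%N -> f (iter (seqn k) T x) <= k.+1%:R) ->
  (forall i, (i0 <= i)%N -> forall N,
    bsum (iter (pshift i) T) (fluctuation f i) N (iter (pos (start i)) T x) <=
    eta * N%:R) ->
  forall i, (i0 <= i)%N -> forall N, (start i + N * plen i <= start i.+1)%N ->
  \sum_(k < start i + N * plen i) f (iter (seqn k) T x) <=
  \sum_(k < start i0) f (iter (seqn k) T x) +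
  \sum_(k < start i + N * plen i) (eta + spread f k x).
Proof.
move=> f0 eta0 ha hb.
have step i : (i0 <= i)%N ->
  \sum_(k < start i) f (iter (seqn k) T x) <=
    \sum_(k < start i0) f (iter (seqn k) T x) +
    \sum_(k < start i) (eta + spread f k x) ->
  forall N, (start i + N * plen i <= start i.+1)%N ->
  \sum_(k < start i + N * plen i) f (iter (seqn k) T x) <=
  \sum_(k < start i0) f (iter (seqn k) T x) +
  \sum_(k < start i + N * plen i) (eta + spread f k x).
  move=> ii h N hN; rewrite !big_split_ord /= addrA; apply: lerD => //.
  apply: phase_bound => // [k /andP[ik _]|]; last exact: hb.
  by apply: ha; apply: leq_trans ik; exact: start_mono.
move=> i ii; apply: (step i ii).
rewrite -(subnKC ii); elim: (i - i0)%N => [|j IH].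
  rewrite addn0 lerDl; apply: sumr_ge0 => k _.
  by rewrite addr_ge0// spread_ge0.
(* A full phase is a whole number of periods, so [step] reaches the next start exactly. *)
rewrite addnS startS; apply: (step _ (leq_addr _ _) IH).
by rewrite -startS.
Qed.

(** [K] is rounded up to the end [K'] of a period. The rounding and the enlargement of windows to
    cells each cost a factor [1 + del], and terms independent of [K] are absorbed in [eta * K]. *)
Lemma average_bound f (e eta C : R) x : (forall x, 0 <= f x) -> 0 <= e -> 0 < eta ->
  (exists k0, forall k, (k0 <= k)%N -> f (iter (seqn k) T x) <= k.+1%:R) ->
  (exists i0, forall i, (i0 <= i)%N -> forall N,
    bsum (iter (pshift i) T) (fluctuation f i) N (iter (pos (start i)) T x) <=
    eta * N%:R) ->
  (forall n, bsum T f n x <= C + (e + eta) * n%:R) ->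
  exists K0, forall K, (K0 <= K)%N ->
    \sum_(k < K) f (iter (seqn k) T x) <= (e + 4 * eta) * K%:R.
Proof.
move=> f0 e0 eta0 [k0 ha] [i0 hb] fC.
(* The size of [m] comes from the final comparison of coefficients, where
   [del * (3 * e + 4 * eta) <= eta] is used. *)
have [m hm] : exists m : nat, (3 * e + 4 * eta) / eta <= m%:R.
  by exists (Num.truncn ((3 * e + 4 * eta) / eta)).+1; exact/ltW/truncnS_gt.
pose i1 := maxn k0 (maxn i0 m.+1).
have i1k : (k0 <= i1)%N by rewrite leq_maxl.
have i1i : (i0 <= i1)%N by rewrite /i1; lia.
have i1m : (m < i1)%N by rewrite /i1; lia.
pose del : R := i1%:R^-1.
have i1R : 0 < i1%:R :> R by rewrite ltr0n; lia.
have del0 : 0 < del by rewrite invr_gt0.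
have del1 : del <= 1 by rewrite invf_le1// ler1n; lia.
have delm : del * (3 * e + 4 * eta) <= eta.
  rewrite /del mulrC ler_pdivrMr// [leRHS]mulrC -ler_pdivrMr//; apply: le_trans hm _.
  by rewrite ler_nat ltnW.
have ce0 : 0 <= e + eta by lra.
pose C1 := \sum_(k < start i1) f (iter (seqn k) T x) + C +
  (e + eta) * (start i1).*2%:R.
have [K1 hK1] : exists K1 : nat, C1 / eta <= K1%:R.
  by exists (Num.truncn (C1 / eta)).+1; exact/ltW/truncnS_gt.
exists (maxn K1 (start i1)) => K; rewrite geq_max => /andP[K1K i1K].
pose i := phase K; have /andP[iK Ki] := phaseP K; rewrite -/i in iK Ki.
have i1_i : (i1 <= i)%N by exact: phase_ge.
(* [N] includes the period containing [K]; it still fits, the phase length being a multiple of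
   [plen i]. *)
pose N := ((K - start i) %/ plen i).+1; have pl := plen_gt0 i.
have KN : (K <= start i + N * plen i)%N.
  rewrite -leq_subLR ltnW//; exact: ltn_ceil.
have NS : (start i + N * plen i <= start i.+1)%N.
  move: Ki; rewrite startS => Ki; rewrite leq_add2l leq_mul2r; apply/orP; right.
  by rewrite /N ltn_divLR//; lia.
have NK : (start i + N * plen i <= K + plen i)%N.
  rewrite /N mulSnr addnA leq_add2r -[leqRHS](subnKC iK) leq_add2l.
  exact: leq_trunc_div.
set K' := (start i + N * plen i)%N in KN NS NK.
apply: (@le_trans _ _ (\sum_(k < K') f (iter (seqn k) T x))).
  rewrite -(subnKC KN) [leRHS]big_split_ord /= lerDl; exact: sumr_ge0.
have h1 : \sum_(k < K') f (iter (seqn k) T x) <=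
    \sum_(k < start i1) f (iter (seqn k) T x) +
    \sum_(k < K') (eta + spread f k x).
  apply: chain_bound => // [|k kk|j ij M]; first exact: ltW.
  - by apply: ha; rewrite (leq_trans i1k)// (leq_trans (start_ge _) kk).
  - by apply: hb; exact: leq_trans ij.
apply: le_trans h1 _.
have h2 := sum_spread_le (start i1) K' ce0 fC.
have p1 : (phase (start i1)).+1%:R^-1 <= del.
  by rewrite /del lef_pV2 ?posrE ?ltr0Sn// ler_nat ltnW// ltnS phase_ge.
rewrite big_split /= sumr_const card_ord -[eta *+ _]mulr_natr.
have K'R : K'%:R <= (1 + del) * K%:R.
  have : K'%:R <= K%:R + (plen i)%:R :> R by rewrite -natrD ler_nat.
  have : (plen i)%:R <= del * K%:R.
    rewrite /del mulrC ler_pdivlMr// -natrM ler_nat mulnC.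
    apply: leq_trans iK; apply: leq_trans (plen_le_start i).
    by rewrite leq_mul2r i1_i orbT.
  lra.
have C1K : C1 <= eta * K%:R.
  by rewrite mulrC -ler_pdivrMr//; apply: le_trans hK1 _; rewrite ler_nat.
have h3 : (e + eta) * ((1 + (phase (start i1)).+1%:R^-1) * K'%:R) <=
    (e + eta) * ((1 + del) * K'%:R).
  by apply: ler_wpM2l => //; apply: ler_wpM2r => //; rewrite lerD2l.
(* Three of the four [eta] are spent here; [C1K] takes the fourth. *)
have h4 : (eta + (e + eta) * (1 + del)) * K'%:R <= (e + 3 * eta) * K%:R.
  apply: (@le_trans _ _ ((eta + (e + eta) * (1 + del)) * ((1 + del) * K%:R))).
    by apply: ler_wpM2l => //; rewrite addr_ge0 ?mulr_ge0//; lra.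
  rewrite mulrA; apply: ler_wpM2r => //.
  rewrite -subr_ge0 [X in 0 <= X](_ : _ =
    (eta - del * (3 * e + 4 * eta)) + del * (1 - del) * (e + eta)); last by ring.
  by rewrite addr_ge0 ?subr_ge0// !mulr_ge0 ?subr_ge0// ltW.
move: h2 h3 h4 C1K; rewrite /C1; clear.
move: (\sum_(k < K') _) (\sum_(k < start i1) _) => a b.
move: (_%:R^-1) (_.*2%:R) (K'%:R) (K%:R) => p q k' k; lra.
Qed.
End deterministic.

(** * Almost everywhere bounds from summable measures *)

Lemma sum_tail_le (R : realDomainType) (v : R) n : 0 <= v ->
  \sum_(k < n) (if k.+1%:R < v then 1 else 0) <= v.
Proof.
move=> v0; have : \sum_(k < n) (if k.+1%:R < v then 1 else 0) <= n%:R :> R.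
  rewrite -[X in X%:R]card_ord -sumr_const ler_sum// => k _; case: ifP => //.
elim: n => [|n IH] h; first by rewrite big_ord0.
have IHn : \sum_(k < n) (if k.+1%:R < v then 1 else 0) <= n%:R :> R.
  rewrite -[X in X%:R]card_ord -sumr_const ler_sum// => k _; case: ifP => //.
rewrite big_ord_recr /=; case: ifP => [nv|_]; last by rewrite addr0 IH.
by apply: ltW; apply: le_lt_trans nv; rewrite -natr1 lerD2r.
Qed.

Lemma sum_half_le (R : realFieldType) n : \sum_(i < n) (2 ^ i)%:R^-1 <= 2 :> R.
Proof.
suff -> : \sum_(i < n) (2 ^ i)%:R^-1 = 2 - 2 * (2 ^ n)%:R^-1 :> R.
  by rewrite lerBlDr lerDl mulr_ge0// invr_ge0.
elim: n => [|n IH]; first by rewrite big_ord0 expn0 invr1 mulr1 subrr.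
rewrite big_ord_recr /= IH expnS natrM invfM.
have -> : 2%:R^-1 = 1 / 2 :> R by rewrite mul1r.
lra.
Qed.

Section ae_bounds.
Context {d : measure_display} {X : measurableType d} {R : realType}.
Variables (mu : probability X R) (T : X -> X) (mT : mpreserving mu T).
Variables (f : X -> R) (nf : nnmeas f) (e : R) (fe : eint mu f = e%:E).

Let mf : measurable_fun setT f. Proof. by case: nf. Qed.
Let f0 x : 0 <= f x. Proof. by case: nf. Qed.
Let e0 : 0 <= e. Proof. by rewrite -lee_fin -fe; exact: eint_ge0. Qed.

Lemma nnmeas_low_part i : nnmeas (low_part f i).
Proof.
split; last by move=> x; rewrite /low_part; case: ifP.
apply: measurable_fun_ifT; [|exact: mf|exact: measurable_cst].
by apply: measurable_fun_ler => //; exact: measurable_cst.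
Qed.

Lemma nnmeas_mid_part i : nnmeas (mid_part f i).
Proof.
split; last by move=> x; rewrite /mid_part; case: ifP.
apply: measurable_fun_ifT; [|exact: mf|exact: measurable_cst].
apply: measurable_and.
  by apply: measurable_fun_ltr => //; exact: measurable_cst.
by apply: measurable_fun_ler => //; exact: measurable_cst.
Qed.

Lemma nnmeas_phase_block i (g : X -> R) : nnmeas g -> nnmeas (phase_block T i g).
Proof.
move=> ng; apply: (nnmeas_sum (wlen i * window i ^ wlen i) (h := fun r x =>
  g (iter (r * cell i + digit (window i) (r %/ wlen i) (r %% wlen i)) T x))).
by move=> r; exact: (nnmeas_comp (mpreserving_iter _ mT) ng).
Qed.

Lemma eint_phase_block i (g : X -> R) : nnmeas g ->
  eint mu (phase_block T i g) = ((plen i)%:R%:E * eint mu g)%E.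
Proof.
move=> ng; rewrite [LHS](@eint_sum _ _ _ mu (wlen i * window i ^ wlen i) (fun r x =>
  g (iter (r * cell i + digit (window i) (r %/ wlen i) (r %% wlen i)) T x))); last first.
  by move=> r; exact: (nnmeas_comp (mpreserving_iter _ mT) ng).
under eq_bigr do rewrite (eint_comp (mpreserving_iter _ mT) ng).
by rewrite sume_const//; apply: eint_ge0; case: ng.
Qed.

Lemma sum_mid_part_le n x : \sum_(i < n) mid_part f i x <= 2 * f x.
Proof.
pose p i : R := (f x <= (cutoff i)%:R)%R%:R.
have p1 i : p i <= 1 by rewrite /p; case: (f x <= _).
(* As [start i.+1 = cutoff i.+2], [mid_part f i] is [f] times [p i.+2 - p i], and the sum telescopes
   with two boundary terms. *)
suff : \sum_(i < n) mid_part f i x <= f x * (p n + p n.+1).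
  move=> /le_trans; apply; rewrite mulrC ler_wpM2r//.
  by have := p1 n; have := p1 n.+1; lra.
elim: n => [|n IH]; first by rewrite big_ord0 mulr_ge0// addr_ge0.
rewrite big_ord_recr /=; apply: (le_trans (lerD IH (lexx _))).
suff : mid_part f n x <= f x * p n.+2 - f x * p n by lra.
rewrite /mid_part /p -cutoffS; set c := cutoff n.+2.
have cc : (cutoff n)%:R <= c%:R :> R.
  rewrite ler_nat /c cutoffS; apply: leq_trans (cutoff_le_start n) _.
  exact/ltnW/start_ltS.
have [h|h] := leP (f x) (cutoff n)%:R; first by rewrite (le_trans h cc) subrr.
by case: (f x <= _); rewrite ?mulr1 ?mulr0 subr0.
Qed.

Lemma sum_eint_mid_part n : (\sum_(i < n) eint mu (mid_part f i) <= (2 * e)%:E)%E.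
Proof.
rewrite -eint_sum; last exact: nnmeas_mid_part.
rewrite EFinM -fe -eintZ//; apply: eint_le.
- exact: (nnmeas_sum n nnmeas_mid_part).
- exact: nnmeasZ.
- exact: sum_mid_part_le.
Qed.

Lemma nnmeas_fluctuation i : nnmeas (fluctuation T f i).
Proof.
apply: nnmeasD; apply: nnmeasZ; rewrite ?invr_ge0//.
  exact/nnmeas_phase_block/nnmeas_mid_part.
apply: nnmeas_norm; apply: (measurable_block_sub_window _ _ _ mT).
by case: (nnmeas_low_part i).
Qed.

(** By invariance the block average of [mid_part] keeps its integral. For the low part,
    [b = 1 / 2 ^ i] is matched to [wlen i = 4 ^ i * (cutoff i).+1], so the second error term is at
    most [e / 2 ^ i]. *)
Lemma eint_fluctuation i :
  (eint mu (fluctuation T f i) <= eint mu (mid_part f i) + ((1 + e) / (2 ^ i)%:R)%:E)%E.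
Proof.
have p0 : 0 < (plen i)%:R :> R by rewrite ltr0n plen_gt0.
rewrite eintD; last 2 first.
- by apply: nnmeasZ; [rewrite invr_ge0|exact/nnmeas_phase_block/nnmeas_mid_part].
- apply: nnmeasZ; [by rewrite invr_ge0|apply: nnmeas_norm].
  by apply: (measurable_block_sub_window _ _ _ mT); case: (nnmeas_low_part i).
apply: leeD.
  rewrite eintZ ?invr_ge0//; last exact/nnmeas_phase_block/nnmeas_mid_part.
  rewrite eint_phase_block; last exact: nnmeas_mid_part.
  by rewrite muleA -EFinM mulVf ?gt_eqF// mul1e.
have L0 : (0 < wlen i)%N by exact: wlen_gt0.
have b0 : 0 < (2 ^ i)%:R^-1 :> R by rewrite invr_gt0 ltr0n expn_gt0.
have lowe : (eint mu (low_part f i) <= e%:E)%E.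
  rewrite -fe; apply: eint_le => //; first exact: nnmeas_low_part.
  by move=> x; rewrite /low_part; case: ifP.
have lowt x : low_part f i x <= (cutoff i)%:R by rewrite /low_part; case: ifP.
apply: le_trans (eint_block_sub_window (cell i) (window_gt0 i) L0 mT (nnmeas_low_part i)
  (ler0n _ _) lowt b0 lowe) _.
rewrite lee_fin mulrDl mul1r lerD2l wlenE natrM.
have -> : (4 ^ i)%:R = (2 ^ i)%:R * (2 ^ i)%:R :> R by rewrite -natrM -expnMn.
have : (cutoff i)%:R <= (cutoff i).+1%:R :> R by rewrite ler_nat.
have : 0 < (cutoff i).+1%:R :> R by rewrite ltr0n.
move: (cutoff i)%:R (cutoff i).+1%:R => c c1 c10 cc1.
have q0 : 0 < (2 ^ i)%:R :> R by rewrite ltr0n expn_gt0.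
move: (2 ^ i)%:R q0 => q q0.
have -> : c * e / (q^-1 * (q * q * c1)) = (e / q) * (c / c1).
  by field; rewrite (gt_eqF q0) (gt_eqF c10).
apply: ler_piMr; first by rewrite divr_ge0// ltW.
by rewrite ler_pdivrMr// mul1r.
Qed.

(** Borel-Cantelli: by invariance the exceptional sets have the measures of the sets [k.+1 < f], and
    [sum_tail_le] bounds their sum by the integral of [f]. *)
Lemma trunc_ae (n : nat -> nat) :
  {ae mu, forall x, exists k0, forall k, (k0 <= k)%N ->
    f (iter (n k) T x) <= k.+1%:R}.
Proof.
pose A k := [set x | k.+1%:R < f x].
have mA k : measurable (A k).
  by apply: measurable_lt_set => //; exact: measurable_cst.
have Afin k : mu (A k) \is a fin_num by exact: fin_num_measure.
have sumA m : \sum_(k < m) fine (mu (A k)) <= e.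
  rewrite -lee_fin -fe -sumEFin.
  rewrite (eq_bigr (fun k : 'I_m => eint mu (\1_(A k)))); last first.
    by move=> k _; rewrite fineK// eint_indic.
  rewrite -(@eint_sum _ _ _ mu m (fun k => \1_(A k))); last first.
    by move=> k; exact: nnmeas_indic.
  apply: eint_le => //.
    by apply: (nnmeas_sum m (h := fun k => \1_(A k))) => k; exact: nnmeas_indic.
  move=> x; apply: le_trans (sum_tail_le m (f0 x)).
  apply: ler_sum => k _; rewrite indicE.
  by case: ifPn => h; [rewrite mem_set|rewrite memNset//; exact/negP].
have mB k : measurable (iter (n k) T @^-1` A k).
  by rewrite -[X in measurable X]setTI; apply: (mpreserving_iter (n k) mT).1.
have Bk k : (mu (iter (n k) T @^-1` A k) <= (fine (mu (A k)))%:E)%E.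
  by rewrite fineK// (mpreserving_iter (n k) mT).2.
apply: filterS (borel_cantelli_ae mB Bk sumA) => x [k0 hk].
by exists k0 => k /hk /= /negP; rewrite -leNgt.
Qed.

(** The maximal inequality for the shift by one period handles all [N] of a phase at once. The
    measures are summable over phases, and pulling back along [iter (pos (start i)) T] preserves
    them. *)
Lemma fluctuation_ae (eta : R) : 0 < eta ->
  {ae mu, forall x, exists i0, forall i, (i0 <= i)%N -> forall N,
    bsum (iter (pshift i) T) (fluctuation T f i) N (iter (pos (start i)) T x) <=
      eta * N%:R}.
Proof.
move=> eta0.
have fl i : (eint mu (fluctuation T f i) < +oo)%E.
  apply: le_lt_trans (eint_fluctuation i) _.
  rewrite lte_add_pinfty ?ltry//; apply: (@le_lt_trans _ _ e%:E); last exact: ltry.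
  rewrite -fe; apply: eint_le => //; first exact: nnmeas_mid_part.
  by move=> x; rewrite /mid_part; case: ifP.
pose B i := [set x | exists n,
  eta * n%:R < bsum (iter (pshift i) T) (fluctuation T f i) n x].
have /all_and2[mB muB] i := maximal_ergodic (mpreserving_iter (pshift i) mT)
  (nnmeas_fluctuation i) (fl i) (ltW eta0).
pose a i := eta^-1 * (fine (eint mu (mid_part f i)) + (1 + e) / (2 ^ i)%:R).
have midfin i : eint mu (mid_part f i) \is a fin_num.
  rewrite ge0_fin_numE; last by apply: eint_ge0; case: (nnmeas_mid_part i).
  apply: (@le_lt_trans _ _ e%:E); last exact: ltry.
  rewrite -fe; apply: eint_le => //; first exact: nnmeas_mid_part.
  by move=> x; rewrite /mid_part; case: ifP.
have Ba i : (mu (iter (pos (start i)) T @^-1` B i) <= (a i)%:E)%E.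
  have [_ ->] := mpreserving_iter (pos (start i)) mT; last exact: mB.
  rewrite EFinM lee_pdivlMl//; apply: le_trans (muB i) _.
  by rewrite EFinD fineK//; exact: eint_fluctuation.
have suma n : \sum_(i < n) a i <= eta^-1 * (2 * e + (1 + e) * 2).
  rewrite -mulr_sumr; apply: ler_wpM2l; first by rewrite invr_ge0 ltW.
  rewrite big_split /=; apply: lerD.
    rewrite -lee_fin -sumEFin; apply: le_trans (sum_eint_mid_part n).
    by apply: lee_sum => i _; rewrite fineK.
  by rewrite -mulr_sumr ler_wpM2l ?addr_ge0//; exact: sum_half_le.
have mBi i : measurable (iter (pos (start i)) T @^-1` B i).
  rewrite -[X in measurable X]setTI.
  by apply: (mpreserving_iter (pos (start i)) mT).1 => //; exact: mB.
apply: filterS (borel_cantelli_ae mBi Ba suma) => x [i0 hi].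
exists i0 => i /hi /= nB N; rewrite leNgt; apply/negP => h.
by apply: nB; exists N.
Qed.

Lemma upper_nonneg (eta : R) : ergodic mu T -> 0 < eta ->
  {ae mu, forall x, exists K0, forall K, (K0 <= K)%N ->
    \sum_(k < K) f (iter (seqn k) T x) <= (e + 4 * eta) * K%:R}.
Proof.
move=> eT eta0.
have fc : (eint mu f < (e + eta)%:E)%E by rewrite fe lte_fin ltrDl.
apply: filterS3 (trunc_ae seqn) (fluctuation_ae eta0) (birkhoff_upper mT eT nf fc).
by move=> x ha hb [C hC]; exact: average_bound hC.
Qed.

End ae_bounds.

(** * Integrable functions of any sign, and the conclusion *)

Lemma upper_integrable {d : measure_display} {X : measurableType d} {R : realType}
    (mu : probability X R) (T : X -> X) (f : X -> R) (eps : R) :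
  mpreserving mu T -> ergodic mu T -> mu.-integrable setT (EFin \o f) -> 0 < eps ->
  {ae mu, forall x, exists K0, forall K, (K0 <= K)%N ->
    \sum_(k < K) f (iter (seqn k) T x) <=
      (fine (\int[mu]_y (f y)%:E) + eps) * K%:R}.
Proof.
move=> mT eT fi eps0; have mf : measurable_fun setT f.
  by apply/measurable_EFinP; exact: measurable_int fi.
have If := integrable_fin_num measurableT fi.
(* Truncation from below makes [F m + m] nonnegative; dominated convergence brings the integral of
   [F m] below that of [f] plus [eps / 2]. *)
pose F (m : nat) x := Num.max (f x) (- m%:R).
have mF m : measurable_fun setT (F m).
  by apply: measurable_maxr => //; exact: measurable_cst.
have Ff m x : `|F m x| <= `|f x|.
  rewrite /F; case: (leP (f x) (- m%:R)) => [h|_//].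
  have : f x <= 0 by apply: le_trans h _; rewrite oppr_le0.
  by move=> h'; rewrite normrN ger0_norm// ler0_norm// lerNr.
have [Fi _ FI] : [/\ mu.-integrable setT (EFin \o f),
    [sequence \int[mu]_x `|(F m x)%:E - (f x)%:E|]_m @ \oo --> 0 &
    [sequence \int[mu]_x (F m x)%:E]_m @ \oo --> \int[mu]_x (f x)%:E]%E.
  apply: (@dominated_convergence _ _ _ mu setT measurableT
    (fun m x => (F m x)%:E) (EFin \o f) (fun x => `|(f x)%:E|)%E) => //.
  - by move=> m; exact/measurable_EFinP.
  - exact/measurable_EFinP.
  - apply: aeW => x _; apply: cvg_near_cst.
    exists (Num.truncn `|f x|).+1 => // m /= hm.
    congr EFin; rewrite /F max_l// lerNl.
    apply: le_trans (ler_norm _) _; rewrite normrN.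
    by apply: le_trans (ltW (truncnS_gt _)) _; rewrite ler_nat.
  - exact: integrable_abse.
  - by apply: aeW => x m _; rewrite lee_fin.
have FiI m : mu.-integrable setT (EFin \o F m).
  apply: le_integrable fi => //; first exact/measurable_EFinP.
  by move=> x _; rewrite lee_fin.
have IF m := integrable_fin_num measurableT (FiI m).
have [m hm] : exists m, (\int[mu]_x (F m x)%:E <
    (fine (\int[mu]_y (f y)%:E) + eps / 2)%:E)%E.
  have : (\int[mu]_x (f x)%:E < (fine (\int[mu]_y (f y)%:E) + eps / 2)%:E)%E.
    by rewrite -[X in (X < _)%E](fineK If) lte_fin ltrDl divr_gt0.
  move=> /open_ereal_lt' /FI [m _ hm].
  by exists m; exact: (hm m (leqnn m)).
pose G x := F m x + m%:R.
have G0 x : 0 <= G x by rewrite /G -lerBlDr sub0r le_max lexx orbT.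
have nG : nnmeas G by split => //; apply: measurable_funD => //; exact: measurable_cst.
have EG : eint mu G = (fine (\int[mu]_x (F m x)%:E)%E + m%:R)%:E.
  rewrite EFinD (fineK (IF m)) -[X in (_ + X)%E](eint_cst mu) /eint -integralD//.
  exact: (finite_measure_integrable_cst mu m%:R measurableT).
(* [upper_nonneg] loses [4 * eta = eps / 2]; truncation took the other half. *)
have eta0 : 0 < eps / 8 by rewrite divr_gt0.
apply: filterS (upper_nonneg mT nG EG eT eta0) => x [K0 hK].
exists K0 => K /hK h.
have : \sum_(k < K) f (iter (seqn k) T x) + m%:R * K%:R <=
    \sum_(k < K) G (iter (seqn k) T x).
  rewrite mulr_natr -[X in _ *+ X]card_ord -sumr_const -big_split /=.
  by apply: ler_sum => k _; rewrite /G lerD2r le_max lexx.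
move=> /le_trans /(_ h).
have hm' : fine (\int[mu]_x (F m x)%:E) <= fine (\int[mu]_y (f y)%:E) + eps / 2.
  by rewrite -lee_fin (fineK (IF m)) ltW.
have : fine (\int[mu]_x (F m x)%:E) * K%:R <=
  (fine (\int[mu]_y (f y)%:E) + eps / 2) * K%:R by rewrite ler_wpM2r.
lra.
Qed.

Theorem theorem2p1 :
  exists n : nat -> nat,
    (forall k, (n k < n k.+1)%N) /\
    (forall M : nat, exists k0 : nat, forall k, (k0 <= k)%N -> (M <= n k.+1 - n k)%N) /\
    (forall (R : realType) (d : measure_display) (X : measurableType d)
            (mu : probability X R) (T : X -> X),
        invertible_mpt mu T -> aperiodic mu T -> ergodic mu T ->
        forall f : X -> R, mu.-integrable setT (EFin \o f) ->
        {ae mu, forall x,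
          (fun K : nat => ((K.+1%:R)^-1 * \sum_(k < K.+1) f (iter (n k) T x))%:E)
            @ \oo --> (\int[mu]_y (f y)%:E)%E}).
Proof.
exists seqn; split; [|split].
- by move=> k; exact: leq_ltn_trans (leq_addr _ _) (seqn_gap k).
- move=> M; exists (start M) => k /phase_ge Mk; have := seqn_gap k.
  by move: (seqn k) (seqn k.+1) (phase k) Mk => a b p; lia.
move=> R d X mu T [mT [_ pT]] _ eT f fi.
have mpT : mpreserving mu T by [].
have If := integrable_fin_num measurableT fi.
have fNi : mu.-integrable setT (EFin \o (fun x => - f x)).
  by rewrite (_ : EFin \o _ = \- (EFin \o f))%E//; exact: integrableN.
have INf : fine (\int[mu]_y (- f y)%:E) = - fine (\int[mu]_y (f y)%:E).
  rewrite -fineN -integralN//; last exact: integrable_add_def.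
have j0 j : 0 < j.+1%:R^-1 :> R by rewrite invr_gt0.
(* Tolerances [1 / j.+1] suffice, and countably many almost sure events, for [f] and for [- f], hold
   together almost surely. *)
have hU := ae_foralln (fun j => upper_integrable mpT eT fi (j0 j)).
have hL := ae_foralln (fun j => upper_integrable mpT eT fNi (j0 j)).
apply: filterS2 hU hL => x hU hL; rewrite -(fineK If).
apply: cvg_EFin; first by apply: nearW.
apply/cvgrPdist_le => eps eps0.
pose j := Num.truncn eps^-1.
have je : j.+1%:R^-1 <= eps.
  by rewrite -[leRHS]invrK lef_pV2 ?posrE ?invr_gt0//; exact/ltW/truncnS_gt.
have [K1 hK1] := hU j; have [K2 hK2] := hL j.
exists (maxn K1 K2) => // K /=; rewrite geq_max => /andP[K1K K2K].
have := hK1 K.+1 (leqW K1K); have := hK2 K.+1 (leqW K2K).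
rewrite sumrN INf; set s := \sum_(k < _) _; set I := fine _ => h1 h2.
have KR : 0 < K.+1%:R :> R by rewrite ltr0n.
set u := _^-1 * s; have sE : s = u * K.+1%:R.
  by rewrite /u mulrAC mulVf ?mul1r// gt_eqF.
move: h1 h2; rewrite sE -mulNr !(ler_pM2r KR) => h1 h2.
rewrite ler_norml; apply/andP; move: je h1 h2.
by move: _%:R^-1 => v; split; lra.
Qed.
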